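(* Let $k, n \ge 1$ be integers. For every tableau $T \in \mathrm{SSYT}(k,[n])$ which has $m$ columns, there is a unique unordered $m$-tuple $(S_1, \ldots, S_m)$ of one-column tableaux in $\mathrm{SSYT}(k,[n])$ which are pairwise noncrossing and such that $T = S_1 \cup \cdots \cup S_m$.
   Context: Notation: $[n]=\{1,\ldots,n\}$. $\mathrm{SSYT}(k,[n])$ is the set of semistandard Young tableaux of rectangular shape with $k$ rows (and arbitrarily many columns) and entries in $[n]$: rows weakly increasing from left to right, columns strictly increasing from top to bottom. A one-column tableau in $\mathrm{SSYT}(k,[n])$ is identified with the $k$-element subset of $[n]$ formed by its entries. An unordered tuple is a multiset (repetitions are allowed). For $S,T\in \mathrm{SSYT}(k,[n])$, $S\cup T$ denotes the row-increasing tableau whose $i$th row is the multiset union of the $i$th rows of $S$ and $T$ (sorted weakly increasingly), for each $i\in[k]$; it is again semistandard. For finite sets of integers $I,J$ write $I<J$ if $\max(I)<\min(J)$ (the condition being vacuous if one of them is empty). Two subsets $I,J\subset[n]$ of the same cardinality are weakly separated if at least one of the following holds: (i) $I\setminus J=I_1\sqcup I_2$ with $I_1<J\setminus I<I_2$; (ii) $J\setminus I=J_1\sqcup J_2$ with $J_1<I\setminus J<J_2$ (the parts $I_1,I_2,J_1,J_2$ may be empty). Two $k$-subsets $I=\{i_1<\cdots<i_k\}$ and $J=\{j_1<\cdots<j_k\}$ of $[n]$ are noncrossing if for each $1\le a<b\le k$, either the pair $\{i_a,i_{a+1},\ldots,i_b\}$, $\{j_a,j_{a+1},\ldots,j_b\}$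 is weakly separated, or $\{i_{a+1},\ldots,i_{b-1}\}\neq\{j_{a+1},\ldots,j_{b-1}\}$. One-column tableaux are called noncrossing if the corresponding $k$-subsets are. *)

(* Defs.v *)
From mathcomp Require Import all_boot.

Set Implicit Arguments.
Unset Strict Implicit.
Unset Printing Implicit Defensive.

(* The alphabet [n] = {1, ..., n} is encoded as 'I_n = {0, ..., n - 1} and the
   row indices 1, ..., k as 'I_k; only the order of the entries matters. *)

Section Tableaux.

Variables k n : nat.

(* A tableau with k rows, given by its rows read from left to right. *)
Definition tableau := {ffun 'I_k -> seq 'I_n}.

Definition ord_le : rel 'I_n := [rel x y : 'I_n | x <= y].
Definition ord_lt : rel 'I_n := [rel x y : 'I_n | x < y].

(* [all2 ord_lt] compares two rows of equal length column by column. *)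
Definition is_SSYT (m : nat) (T : tableau) : bool :=
  [&& [forall i, size (T i) == m],
      [forall i, sorted ord_le (T i)] &
      [forall i : 'I_k, forall j : 'I_k, (i < j) ==> all2 ord_lt (T i) (T j)]].

Definition tableau0 : tableau := [ffun=> [::]].

Definition tableauU (S T : tableau) : tableau :=
  [ffun i => sort ord_le (S i ++ T i)].

Definition tableau_entries (S : tableau) : {set 'I_n} :=
  [set x | [exists i, x \in S i]].

(* max I < min J, vacuous if I or J is empty. *)
Definition set_lt (I J : {set 'I_n}) : bool :=
  [forall x in I, forall y in J, x < y].

Definition splits_around (A B : {set 'I_n}) : bool :=
  [exists A1 : {set 'I_n}, exists A2 : {set 'I_n},
    [&& A == A1 :|: A2, [disjoint A1 & A2], set_lt A1 B & set_lt B A2]].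

(* Only meaningful (and only used) for sets of the same cardinality. *)
Definition weakly_separated (I J : {set 'I_n}) : bool :=
  splits_around (I :\: J) (J :\: I) || splits_around (J :\: I) (I :\: J).

(* [enum I] lists I increasingly, so the elements of index a, ..., b in it are
   i_a, ..., i_b when I = {i_0 < ... < i_(k - 1)}. *)
Definition segment (I : {set 'I_n}) (a b : nat) : {set 'I_n} :=
  [set x in I | a <= index x (enum I) <= b].

Definition inner_segment (I : {set 'I_n}) (a b : nat) : {set 'I_n} :=
  [set x in I | a < index x (enum I) < b].

(* Noncrossing k-subsets, with indices 0 <= a < b < k. *)
Definition noncrossing (I J : {set 'I_n}) : bool :=
  [forall a : 'I_k, forall b : 'I_k, (a < b) ==>
     weakly_separated (segment I a b) (segment J a b)
     || (inner_segment I a b != inner_segment J a b)].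

Definition noncrossing_columns (S S' : tableau) : bool :=
  noncrossing (tableau_entries S) (tableau_entries S').

(* (S_1, ..., S_m) consists of pairwise noncrossing one-column tableaux with
   T = S_1 U ... U S_m. *)
Definition noncrossing_decomposition (m : nat) (T : tableau)
    (s : m.-tuple tableau) : Prop :=
  [/\ {in s, forall S, is_SSYT 1 S},
      forall i j : 'I_m, i != j -> noncrossing_columns (tnth s i) (tnth s j) &
      T = \big[tableauU/tableau0]_(S <- s) S].

End Tableaux.

(* Main.v *)
(* Only the sorted rows of T are known, so a decomposition is a way of
   threading them into columns, one row at a time.  Compare prefixes of columns
   at the last row where they differ.  Two columns v < w (before row b) are
   noncrossing at row b iff v_b <= w_(b-1) or v_b >= w_b.  Hence, in row b, the
   largest prefix must receive the least entry exceeding its last one; removing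
   both and iterating determines the extended prefixes as a multiset, and this
   greedy choice never gets stuck since it preserves Hall's condition. *)
Require Import Defs.
From mathcomp Require Import all_boot all_order zify.
Import Order.Theory.
Set Implicit Arguments.
Unset Strict Implicit.
Unset Printing Implicit Defensive.

(** * Extremal elements of finite lists *)

Lemma exists_max d (T : orderType d) (s : seq T) (x : T) : x \in s ->
  exists2 w, w \in s & {in s, forall v, (v <= w)%O}.
Proof.
elim: s x => // y s IHs x _; case: s IHs => [|z s] IHs.
  by exists y; [rewrite mem_head | move=> v; rewrite inE => /eqP->].
have [w ws maxw] := IHs z (mem_head _ _).
have [le_yw | lt_wy] := leP y w.
  exists w; first by rewrite inE ws orbT.
  by move=> v; rewrite inE => /predU1P[-> // | /maxw].
exists y; first exact: mem_head.
by move=> v; rewrite inE => /predU1P[-> // | /maxw/le_trans-> //]; apply: ltW.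
Qed.

Lemma least_filter (p : pred nat) (s : seq nat) : has p s ->
  exists x, [/\ x \in s, p x & {in s, forall y, p y -> x <= y}].
Proof.
case/hasP=> x0 x0s px0.
have ex : exists x, (x \in s) && p x by exists x0; rewrite x0s.
have [x /andP[xs px] minx] := ex_minnP ex.
by exists x; split=> // y ys py; apply: minx; rewrite ys.
Qed.

(** * Extending the prefixes by one row *)

(* The prefix i_1 < ... < i_r of a column is the word i_r ... i_1, so that
   prefixes compare lexicographically by the last entry where they differ. *)
Definition word := seqlexi nat.

Lemma le_head (v w : word) : (v <= w)%O -> head 0 v <= head 0 w.
Proof. by case: v w => [|x v] [|y w] //; rewrite lexi_cons => /andP[]. Qed.

(* Strictness down the columns, and noncrossing at the last row. *)
Definition greedy (Q : seq word) : Prop :=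
  {in Q, forall p, p != [::] /\ head 0 (behead p) < head 0 p} /\
  {in Q &, forall p q : word, ((behead q : word) < (behead p : word))%O ->
     (head 0 q <= head 0 (behead p)) || (head 0 p <= head 0 q)}.

Lemma greedy_sub (Q Q' : seq word) : {subset Q' <= Q} -> greedy Q -> greedy Q'.
Proof. by move=> sQ [g1 g2]; split; [apply: sub_in1 g1 | apply: sub_in2 g2]. Qed.

(** The value [x] depends only on the largest prefix [w] and the multiset of last letters, not on
    how they are joined. This is what makes the extension unique. *)
Lemma greedy_least (Q : seq word) (w : word) : greedy Q ->
  (w : word) \in [seq behead p : word | p <- Q] ->
  {in [seq behead p : word | p <- Q], forall v, (v <= w)%O} ->
  exists x, [/\ ((x :: w) : word) \in Q, head 0 w < x &
    {in [seq head 0 p | p <- Q], forall y, head 0 w < y -> x <= y}].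
Proof.
move=> [g1 g2] /mapP[p0 p0Q def_w] maxw.
(* [W] collects the letters placed on top of [w]; its least element is the candidate for [x]. *)
pose W := [seq head 0 p | p <- Q & behead p == w].
have /least_filter[x [xW _ minx]] : has xpredT W.
  apply/hasP; exists (head 0 p0) => //; apply: map_f.
  by rewrite mem_filter p0Q def_w eqxx.
move: xW => /mapP[p]; rewrite mem_filter => /andP[/eqP pw pQ] def_x.
have [p0' ltp] := g1 p pQ.
have def_p : p = x :: w by case: (p) p0' pw def_x => //= a b _ -> ->.
exists x; split; rewrite -?def_p //; first by rewrite def_x -pw.
move=> y /mapP[q qQ def_y] lt_wy.
(* A letter above a smaller prefix is controlled by noncrossing with [p = x :: w]: being greater
   than [head 0 w], it must be at least [x]. *)
have [lt_qw | le_wq] := ltP (behead q : word) w.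
  have := g2 p q pQ qQ; rewrite pw => /(_ lt_qw).
  by rewrite -def_x -def_y leqNgt lt_wy.
apply: minx => //; rewrite def_y; apply: map_f; rewrite mem_filter qQ andbT.
by apply/eqP; apply: (@le_anti _ word); rewrite le_wq maxw //; apply: map_f.
Qed.

(** Induction on the size: both families contain the same word [x :: w] over the largest prefix [w],
    and deleting it from both preserves all hypotheses. *)
Lemma greedy_unique (Q Q' : seq word) : greedy Q -> greedy Q' ->
  perm_eq [seq behead p : word | p <- Q] [seq behead p : word | p <- Q'] ->
  perm_eq [seq head 0 p | p <- Q] [seq head 0 p | p <- Q'] -> perm_eq Q Q'.
Proof.
have [m] := ubnP (size Q); elim: m Q Q' => // m IHm Q Q' szQ gQ gQ' eqB eqH.
have [Q0 | [q qQ]] : Q = [::] \/ exists q, q \in Q.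
- by case: (Q) => [|q Q1]; [left | right; exists q; rewrite mem_head].
- by move: eqB; rewrite Q0 /= perm_sym => /perm_nilP; case: (Q').
have [w wQ maxw] := exists_max (map_f (behead : word -> word) qQ).
have [x [xQ ltx minx]] := greedy_least gQ wQ maxw.
have [||x' [xQ' ltx' minx']] := @greedy_least Q' w gQ'.
- by rewrite -(perm_mem eqB).
- by move=> v; rewrite -(perm_mem eqB); apply: maxw.
(* Each of [x], [x'] occurs among the last letters of both families and exceeds [head 0 w], so
   minimality applies in both directions. *)
have eqx : x' = x.
  have hx : x \in [seq head 0 p | p <- Q] by apply/mapP; exists (x :: w).
  have hx' : x' \in [seq head 0 p | p <- Q'] by apply/mapP; exists (x' :: w).
  apply/eqP; rewrite eqn_leq minx' -?(perm_mem eqH) //= minx //.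
  by rewrite (perm_mem eqH).
subst x'.
have pQ := perm_to_rem xQ; have pQ' := perm_to_rem xQ'.
rewrite (permPl pQ) (permPr pQ') perm_cons; apply: IHm.
- by rewrite size_rem //; case: (Q) xQ szQ.
- by apply: greedy_sub gQ; apply: mem_rem.
- by apply: greedy_sub gQ'; apply: mem_rem.
- move: eqB; rewrite (permPl (perm_map _ pQ)) (permPr (perm_map _ pQ')).
  by rewrite /= perm_cons.
move: eqH; rewrite (permPl (perm_map _ pQ)) (permPr (perm_map _ pQ')).
by rewrite /= perm_cons.
Qed.

(* Hall's condition for matching each entry of [X] with a larger one of [Y]. *)
Definition hall (X Y : seq nat) : Prop :=
  forall t, count (fun x => t <= x) X <= count (fun y => t < y) Y.

(* The removed entry of [Y] is at least [x], the largest entry of [X]. *)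
Lemma hall_rem (x y : nat) (X Y : seq nat) : x \in X -> y \in Y -> x < y ->
  {in X, forall z, z <= x} -> hall X Y -> hall (rem x X) (rem y Y).
Proof.
move=> xX yY lt_xy maxx hXY t; rewrite !count_rem xX yY /=.
(* For [t <= x] both counts drop by one, as [t <= x < y]; for [t > x] the left count is zero by
   maximality of [x]. *)
have [le_tx | lt_xt] := leqP t x.
  by rewrite (leq_ltn_trans le_tx lt_xy) leq_sub2r.
rewrite (@eq_in_count _ _ pred0) ?count_pred0 // => z /maxx le_zx /=.
by apply/negbTE; rewrite -ltnNge (leq_ltn_trans le_zx).
Qed.

(** The greedy matching is built recursively: the largest prefix [w] takes the least letter [x]
    above its own last one, and [hall_rem] keeps Hall's condition for the rest. *)
Lemma greedy_exists (P : seq word) (X : seq nat) : size P = size X ->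
  hall [seq head 0 p | p <- P] X ->
  exists Q : seq word, [/\ greedy Q, perm_eq [seq behead q : word | q <- Q] P &
    perm_eq [seq head 0 q | q <- Q] X].
Proof.
have [m] := ubnP (size P); elim: m P X => // m IHm P X szP eqsz hPX.
have [P0 | [q qP]] : P = [::] \/ exists q, q \in P.
- by case: (P) => [|q P1]; [left | right; exists q; rewrite mem_head].
- by exists [::]; case: (X) eqsz; rewrite P0.
have [w wP maxw] := exists_max qP.
have wH : head 0 w \in [seq head 0 p | p <- P] by apply: map_f.
(* Hall's condition at [t = head 0 w] provides a letter greater than [head 0 w]. *)
have /least_filter[x [xX lt_wx minx]] : has (fun y => head 0 w < y) X.
  rewrite has_count; apply: leq_trans (hPX _); rewrite -has_count.
  by apply/hasP; exists (head 0 w).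
have pP := perm_to_rem wP; have pX := perm_to_rem xX.
have [||| Q [gQ eqB eqH]] := IHm (rem w P) (rem x X).
- by rewrite size_rem //; case: (P) wP szP.
- by rewrite !size_rem // eqsz.
- have := hall_rem wH xX lt_wx _ hPX => /(_ _) hall' t.
  rewrite (leq_trans _ (hall' _ t)) //; last first.
    by move=> _ /mapP[v vP ->]; apply/le_head/maxw.
  have : perm_eq (head 0 w :: [seq head 0 p | p <- rem w P])
                 (head 0 w :: rem (head 0 w) [seq head 0 p | p <- P]).
    by rewrite -(permPr (perm_to_rem wH)) perm_sym (perm_map _ pP).
  by rewrite perm_cons => /permP->.
have memP q1 : q1 \in Q -> (behead q1 : word) \in P.
  move=> q1Q; apply: (@mem_rem _ w); rewrite -(perm_mem eqB).
  exact: (map_f (behead : word -> word)).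
have memX q1 : q1 \in Q -> head 0 q1 \in X.
  by move=> q1Q; apply: (@mem_rem _ x); rewrite -(perm_mem eqH) map_f.
exists ((x :: w) :: Q); split; last 2 first.
- by rewrite /= (permPr pP) perm_cons.
- by rewrite /= (permPr pX) perm_cons.
case: gQ => g1 g2; split.
  by move=> p; rewrite inE => /predU1P[-> // | /g1].
(* The new word [x :: w] can only have the larger prefix of the pair, by maximality of [w]; then
   minimality of [x] in [X] gives the required alternative. *)
move=> p1 q1; rewrite !inE => /predU1P[-> | p1Q] /predU1P[-> | q1Q] /=.
- by rewrite ltxx.
- move=> _; case: leqP => //= /minx; apply; exact: memX.
- by rewrite lt_leAnge maxw ?andbF // memP.
- exact: g2.
Qed.

(** * Iteration over the rows *)

(* [R r] lists the entries of row r, all positive, so that the default value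
   [head 0 [::]] below the first row imposes no constraint on it. *)
Section Words.

Variables (R : nat -> seq nat) (m : nat).

(** Stripping the last letters leaves the same problem with one row fewer. Before the first row
    there are [m] indistinguishable empty prefixes. *)
Fixpoint words_of (r : nat) (Q : seq word) : Prop :=
  if r is r'.+1 then
    [/\ greedy Q, perm_eq [seq head 0 p | p <- Q] (R r') &
        words_of r' [seq behead p : word | p <- Q]]
  else perm_eq Q (nseq m [::]).

Lemma words_of_perm r Q Q' : perm_eq Q Q' -> words_of r Q -> words_of r Q'.
Proof.
elim: r Q Q' => [|r IHr] Q Q' eqQ /=; first by rewrite (permPl eqQ).
case=> gQ eqH wQ; split.
- by apply: greedy_sub gQ => q; rewrite (perm_mem eqQ).
- by rewrite -(permPl (perm_map _ eqQ)).
- by apply: IHr wQ; apply: perm_map.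
Qed.

Lemma words_of_unique r Q Q' : words_of r Q -> words_of r Q' -> perm_eq Q Q'.
Proof.
elim: r Q Q' => [|r IHr] Q Q' /=.
  by move=> eqQ eqQ'; rewrite (permPl eqQ) perm_sym.
case=> gQ eqH wQ [gQ' eqH' wQ']; apply: greedy_unique => //; first exact: IHr.
by rewrite (permPl eqH) perm_sym.
Qed.

Lemma words_of_exists r : (forall i, i < r -> size (R i) = m) ->
  (0 < r -> all (ltn 0) (R 0)) ->
  (forall i, i.+1 < r -> hall (R i) (R i.+1)) -> exists Q, words_of r Q.
Proof.
elim: r => [|r IHr] szR R0 hR; first by exists (nseq m [::]); rewrite /= perm_refl.
have [|||P wP] := IHr.
- by move=> i lt_ir; rewrite szR // ltnW.
- by move=> _; apply: R0.
- by move=> i lt_ir; apply/hR/ltnW.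
have [||Q [gQ eqB eqH]] := @greedy_exists P (R r).
- rewrite szR //; case: (r) wP szR => [|r'] /=.
    by move/perm_size->; rewrite size_nseq.
  by case=> _ /perm_size + _ szR; rewrite size_map => ->; rewrite szR.
- case: (r) wP szR R0 hR => [|r'] /=; last first.
    by move=> [_ eqH _] _ _ hR t; rewrite (permP eqH) hR.
  (* First row: every prefix has default last entry 0. Hall's condition at [t = 0] asks for [m]
     positive entries, and for [t > 0] its left side vanishes. *)
  move=> eqPm szR R0 _ t; rewrite (permP (perm_map _ eqPm)) map_nseq count_nseq.
  case: t => [|t]; last by rewrite mul0n.
  by rewrite mul1n -(szR 0) //; move: (R0 isT); rewrite all_count => /eqP->.
exists Q; split=> //; apply: words_of_perm wP; by rewrite perm_sym.
Qed.

End Words.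

(** * Crossings and the order on prefixes *)

(** Up to exchanging [v] and [w], this is the only way to violate noncrossing at rows [a] and [b]:
    when the inner rows agree, only the four end entries matter, and they must alternate. *)
Definition crossing (v w : nat -> nat) (a b : nat) : Prop :=
  [/\ forall l, a < l < b -> v l = w l, v a < w a, w a < v b & v b < w b].

Fixpoint code (v : nat -> nat) (r : nat) : word :=
  if r is r'.+1 then v r' :: code v r' else [::].

Lemma eq_code (v w : nat -> nat) r : (forall i, i < r -> v i = w i) ->
  code v r = code w r.
Proof. by elim: r => //= r IHr eq_vw; rewrite eq_vw // IHr // => i /ltnW/eq_vw. Qed.

Lemma code_ltP (v w : nat -> nat) r : (code v r < code w r)%O <->
  exists a, [/\ a < r, v a < w a & forall l, a < l < r -> v l = w l].
Proof.
elim: r => [|r IHr] /=; first by rewrite ltxx; split=> // -[a []].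
rewrite ltxi_cons !leEnat; split.
  case/andP=> le_vw /implyP imp; case: (ltnP (v r) (w r)) => [lt_vw | le_wv].
    by exists r; split=> // l; lia.
  have /IHr[a [lt_ar lt_a eq_a]] := imp le_wv.
  exists a; split=> // [|l lt_l]; first exact: ltnW.
  by case: (eqVneq l r) => [-> | nlr]; [lia | apply: eq_a; lia].
case=> a [lt_ar lt_a eq_a]; case: (eqVneq a r) => [<- | nar].
  by rewrite (ltnW lt_a) leqNgt lt_a.
rewrite (eq_a r) ?leqnn /=; last lia.
by apply/IHr; exists a; split=> // [|l lt_l]; [lia | apply: eq_a; lia].
Qed.

(** Only the last differing row [a] before [r] can start a crossing that ends at [r]. Below [a] the
    two columns agree, so [w a < v r] is equivalent to [w (r - 1) < v r] by monotonicity. *)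
Lemma greedy_crossingP (v w : nat -> nat) r :
  (forall i j, i < j <= r -> v i < v j) -> (forall i j, i < j <= r -> w i < w j) ->
  ((code v r < code w r)%O -> (v r <= head 0 (code w r)) || (w r <= v r)) <->
  (forall a, a < r -> ~ crossing v w a r).
Proof.
move=> mono_v mono_w; split.
  move=> ncr a lt_ar [eq_a lt_a lt_b lt_r].
  have /ncr : (code v r < code w r)%O by apply/code_ltP; exists a.
  case: r lt_ar mono_v mono_w eq_a lt_b lt_r {ncr} => //= r lt_ar mv mw eq_a lt_b lt_r.
  rewrite [w r.+1 <= _]leqNgt lt_r orbF; case: (eqVneq a r) => [eq_ar | nar].
    by subst r; lia.
  by rewrite -eq_a; [have := mv r r.+1; lia | move/eqP: nar; lia].
move=> ncr /code_ltP[a [lt_ar lt_a eq_a]].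
case: (leqP (w r) (v r)) => [|lt_r]; first by rewrite orbT.
case: (leqP (v r) (w a)) => [le_a | gt_a]; last by case: (ncr a lt_ar).
rewrite orbF (leq_trans le_a) //; case: r lt_ar mono_w {ncr eq_a mono_v le_a lt_r} => //= r.
rewrite ltnS leq_eqVlt => /predU1P[-> // | lt_ar] mono_w.
by apply/ltnW/mono_w; rewrite lt_ar /=.
Qed.

(** * One-column tableaux and their entry sets *)

Section Columns.

Variables k n : nat.

Definition column (x : 'I_k -> 'I_n) : tableau k n := [ffun i => [:: x i]].

Definition increasing (x : 'I_k -> 'I_n) : Prop := forall i j : 'I_k, i < j -> x i < x j.

(* Shifted back to 1, ..., n; junk value 0 for r >= k. *)
Definition entry (C : tableau k n) (r : nat) : nat :=
  oapp (fun i => head 0 [seq (x : 'I_n).+1 | x <- C i]) 0 (insub r).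

Lemma columnP (C : tableau k n) : is_SSYT 1 C <->
  exists2 x, C = column x & increasing x.
Proof.
split.
  case/and3P=> /forallP szS _ /forallP ltS.
  have [x Sx] : exists x : 'I_k -> 'I_n, C = column x.
    have exS i : exists y, C i == [:: y].
      by have := szS i; case: (C i) => [|y [|]] // _; exists y.
    exists (fun i => xchoose (exS i)); apply/ffunP=> i; rewrite ffunE.
    by apply/eqP; apply: (xchooseP (exS i)).
  exists x => // i j lt_ij; have /forallP/(_ j)/implyP/(_ lt_ij) := ltS i.
  by rewrite Sx !ffunE /= andbT.
case=> x -> incx; apply/and3P; split; apply/forallP=> i; rewrite ?ffunE //.
by apply/forallP=> j; apply/implyP=> /incx ltx; rewrite !ffunE /= andbT.
Qed.

Lemma entry_column (x : 'I_k -> 'I_n) (i : 'I_k) : entry (column x) i = (x i).+1.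
Proof. by rewrite /entry valK /= ffunE. Qed.

Lemma entry_increasing (x : 'I_k -> 'I_n) i j : increasing x -> i < j < k ->
  entry (column x) i < entry (column x) j.
Proof.
move=> incx /andP[lt_ij lt_jk]; have lt_ik := ltn_trans lt_ij lt_jk.
rewrite -[i]/(val (Ordinal lt_ik)) -[j]/(val (Ordinal lt_jk)) !entry_column ltnS.
exact: incx.
Qed.

Lemma lt_trans_ord : transitive (@ord_lt n).
Proof. by move=> y x z; apply: ltn_trans. Qed.

Lemma lt_irr_ord : irreflexive (@ord_lt n).
Proof. by move=> x; apply: ltnn. Qed.

Lemma sorted_enum_ord (A : {set 'I_n}) : sorted (@ord_lt n) (enum A).
Proof.
rewrite {1}/enum_mem -enumT; apply: sorted_filter; first exact: lt_trans_ord.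
by rewrite -(@sorted_map _ _ val ltn) val_enum_ord iota_ltn_sorted.
Qed.

Lemma sorted_image (x : 'I_k -> 'I_n) (P : pred 'I_k) : increasing x ->
  sorted (@ord_lt n) [seq x i | i <- enum 'I_k & P i].
Proof.
move=> incx; rewrite sorted_map.
apply: (@sub_sorted _ (relpre val ltn)); first by move=> i j /incx.
apply: sorted_filter; first by move=> j i l; apply: ltn_trans.
by rewrite -(@sorted_map _ _ val ltn) val_enum_ord iota_ltn_sorted.
Qed.

Lemma increasing_inj (x : 'I_k -> 'I_n) : increasing x -> injective x.
Proof.
move=> incx i j eq_x; apply: val_inj.
by case: (ltngtP i j) => // /(incx _ _); rewrite eq_x ltnn.
Qed.

Lemma enum_entries (x : 'I_k -> 'I_n) : increasing x ->
  enum (tableau_entries (column x)) = [seq x i | i <- enum 'I_k].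
Proof.
move=> incx; apply: (irr_sorted_eq lt_trans_ord lt_irr_ord).
- exact: sorted_enum_ord.
- by have := sorted_image xpredT incx; rewrite filter_predT.
move=> z; rewrite mem_enum inE; apply/existsP/mapP => [[i] | [i _ ->]].
  by rewrite ffunE inE => /eqP->; exists i; rewrite ?mem_enum.
by exists i; rewrite ffunE mem_head.
Qed.

(** Turns the positions in [enum] used by [segment] and [inner_segment] into row numbers. *)
Lemma index_entries (x : 'I_k -> 'I_n) (i : 'I_k) : increasing x ->
  index (x i) (enum (tableau_entries (column x))) = i.
Proof.
by move=> incx; rewrite enum_entries // index_map ?index_enum_ord //; apply: increasing_inj.
Qed.

Lemma mem_entries (x : 'I_k -> 'I_n) (P : pred nat) (z : 'I_n) : increasing x ->
  reflect (exists2 i : 'I_k, P i & z = x i)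
    ((z \in tableau_entries (column x)) &&
       P (index z (enum (tableau_entries (column x))))).
Proof.
move=> incx; apply: (iffP andP).
  case; rewrite inE => /existsP[i]; rewrite ffunE inE => /eqP->.
  by rewrite index_entries //; exists i.
case=> i Pi ->; rewrite index_entries //; split=> //.
by rewrite inE; apply/existsP; exists i; rewrite ffunE mem_head.
Qed.

Lemma segmentP (x : 'I_k -> 'I_n) a b (z : 'I_n) : increasing x ->
  reflect (exists2 i : 'I_k, a <= i <= b & z = x i)
    (z \in segment (tableau_entries (column x)) a b).
Proof.
by move=> incx; rewrite inE; apply: (mem_entries (fun l => a <= l <= b)).
Qed.

Lemma inner_segmentP (x : 'I_k -> 'I_n) a b (z : 'I_n) : increasing x ->
  reflect (exists2 i : 'I_k, a < i < b & z = x i)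
    (z \in inner_segment (tableau_entries (column x)) a b).
Proof.
by move=> incx; rewrite inE; apply: (mem_entries (fun l => a < l < b)).
Qed.

(** A finite set has only one strictly increasing listing, so equal sets of inner entries agree row
    by row. *)
Lemma inner_segment_eq (x y : 'I_k -> 'I_n) a b : increasing x -> increasing y ->
  inner_segment (tableau_entries (column x)) a b =
    inner_segment (tableau_entries (column y)) a b <->
  (forall l : 'I_k, a < l < b -> x l = y l).
Proof.
move=> incx incy; split=> [eqI | eq_xy]; last first.
  apply/setP=> z; apply/inner_segmentP/inner_segmentP=> // -[i lt_i ->];
  by exists i; rewrite ?eq_xy.
have : [seq x i | i : 'I_k <- enum 'I_k & a < i < b] =
    [seq y i | i : 'I_k <- enum 'I_k & a < i < b].
  apply: (irr_sorted_eq lt_trans_ord lt_irr_ord); try exact: sorted_image.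
  have imP u : increasing u -> [seq u i | i : 'I_k <- enum 'I_k & a < i < b] =i
      inner_segment (tableau_entries (column u)) a b.
    move=> incu z; apply/mapP/inner_segmentP=> // -[i].
      by rewrite mem_filter => /andP[lt_i _] ->; exists i.
    by move=> lt_i ->; exists i; rewrite // mem_filter lt_i mem_enum.
  by move=> z; rewrite !imP // eqI.
by move/eq_in_map=> eqm l lt_l; apply: eqm; rewrite mem_filter lt_l mem_enum.
Qed.

(** * Weak separation of segments *)

Lemma splits_aroundP (A B : {set 'I_n}) : [disjoint A & B] ->
  reflect (forall p u v, p \in A -> u \in B -> v \in B -> ~~ (u < p < v))
    (splits_around A B).
Proof.
move=> disAB; apply: (iffP existsP).
  case=> A1 /existsP[A2 /and4P[/eqP-> _ lt1 lt2]] p u v.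
  rewrite inE => /orP[pA1 | pA2] uB vB.
    by have /forall_inP/(_ _ uB) := forall_inP lt1 p pA1; lia.
  by have /forall_inP/(_ _ pA2) := forall_inP lt2 v vB; lia.
(* [A1] takes the elements of [A] below all of [B]. Any other [p] in [A] has some [u] in [B] with
   [u <= p], strictly by disjointness, so no [v] in [B] lies above [p]. *)
move=> notbtw; pose A1 := [set p in A | [forall u in B, p < u]].
exists A1; apply/existsP; exists (A :\: A1); apply/and4P; split.
- apply/eqP/setP=> p; rewrite !inE.
  by case: (p \in A); case: [forall _ in _, _].
- by rewrite disjoints_subset; apply/subsetP=> p pA1; rewrite in_setC in_setD pA1.
- by apply/forall_inP=> p; rewrite inE => /andP[].
apply/forall_inP=> v vB; apply/forall_inP=> p; rewrite !inE => /andP[+ pA].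
rewrite pA /= => /forall_inPn[u uB le_up].
have neq z : z \in B -> p <> z :> nat.
  move=> zB /val_inj eq_pz; move/pred0P/(_ p): disAB.
  by rewrite /= pA eq_pz zB.
by have := notbtw p u v pA uB vB; have := neq u uB; have := neq v vB; lia.
Qed.

(** Common inner entries cancel, and an end entry of [x] never equals an inner entry of [y], since
    that is also an inner entry of [x]. *)
Lemma segment_setDP (x y : 'I_k -> 'I_n) (a b : 'I_k) (z : 'I_n) :
  increasing x -> increasing y -> a < b -> (forall l : 'I_k, a < l < b -> x l = y l) ->
  (z \in segment (tableau_entries (column x)) a b :\:
         segment (tableau_entries (column y)) a b) =
  ((z == x a) || (z == x b)) && ((z != y a) && (z != y b)).
Proof.
move=> incx incy lt_ab eq_xy.
have lxa (l : 'I_k) : a < l -> x a < x l by apply: incx.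
have lxb (l : 'I_k) : l < b -> x l < x b by apply: incx.
have ends (l : 'I_k) : a <= l <= b -> [\/ l = a, l = b | a < l < b].
  move=> lt_l; case: (eqVneq l a) => [-> | nla]; first by constructor 1.
  case: (eqVneq l b) => [-> | nlb]; first by constructor 2.
  by constructor 3; move: nla nlb; rewrite -!(inj_eq val_inj) /=; lia.
rewrite in_setD; apply/andP/andP => [[zNy /(segmentP _ _ _ incx)[i lt_i def_z]] | ].
  have zNy' (j : 'I_k) : a <= j <= b -> z != y j.
    by move=> lt_j; apply: contraNneq zNy => ->; apply/segmentP => //; exists j.
  rewrite !zNy' ?leqnn ?(ltnW lt_ab) //; split=> //.
  have [def_i | def_i | lt_i'] := ends i lt_i; rewrite def_z ?def_i ?eqxx ?orbT //.
  by have := zNy' i lt_i; rewrite def_z eq_xy ?eqxx.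
case=> zx /andP[nza nzb]; split; last first.
  apply/segmentP=> //; case/orP: zx => /eqP->.
    by exists a; rewrite // leqnn ltnW.
  by exists b; rewrite // leqnn ltnW.
apply/negP=> /(segmentP _ _ _ incy)[j lt_j def_z].
have [def_j | def_j | lt_j'] := ends j lt_j.
- by rewrite def_z def_j eqxx in nza.
- by rewrite def_z def_j eqxx in nzb.
case/andP: lt_j' => lt_aj lt_jb; have eq_j : x j = y j by rewrite eq_xy ?lt_aj.
have := lxa j lt_aj; have := lxb j lt_jb; rewrite eq_j -def_z.
by case/orP: zx => /eqP->; rewrite ltnn.
Qed.

(** A crossing puts all four end entries in the differences, each difference having an element
    strictly between two of the other. Conversely, if both splittings fail, some end of [x] lies
    strictly between the ends of [y] and vice versa, which forces one of the two alternating
    patterns. *)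
Lemma weakly_separatedP (x y : 'I_k -> 'I_n) (a b : 'I_k) :
  increasing x -> increasing y -> a < b -> (forall l : 'I_k, a < l < b -> x l = y l) ->
  weakly_separated (segment (tableau_entries (column x)) a b)
    (segment (tableau_entries (column y)) a b) <->
  ~ [&& x a < y a, y a < x b & x b < y b] /\ ~ [&& y a < x a, x a < y b & y b < x b].
Proof.
move=> incx incy lt_ab eq_xy.
have eq_yx (l : 'I_k) : a < l < b -> y l = x l by move/eq_xy.
have ltx := incx a b lt_ab; have lty := incy a b lt_ab.
set A := segment _ a b; set B := segment (tableau_entries (column y)) a b.
have memA z := segment_setDP z incx incy lt_ab eq_xy.
have memB z := segment_setDP z incy incx lt_ab eq_yx.
have disAB : [disjoint A :\: B & B :\: A].
  by apply/pred0P=> z /=; rewrite !in_setD; case: (z \in A); rewrite /= ?andbF.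
have disBA : [disjoint B :\: A & A :\: B] by rewrite disjoint_sym.
split.
  move=> ws.
  suff : ~ ([&& x a < y a, y a < x b & x b < y b] \/
      [&& y a < x a, x a < y b & y b < x b]) by tauto.
  move=> cr.
  have [xaA xbA yaB ybB] : [/\ x a \in A :\: B, x b \in A :\: B,
      y a \in B :\: A & y b \in B :\: A].
    by split; rewrite ?memA ?memB -!(inj_eq val_inj) /=; lia.
  case/orP: ws => [/(splits_aroundP disAB) nbtw | /(splits_aroundP disBA) nbtw].
    have := nbtw (x a) (y a) (y b) xaA yaB ybB.
    by have := nbtw (x b) (y a) (y b) xbA yaB ybB; lia.
  have := nbtw (y a) (x a) (x b) yaB xaA xbA.
  by have := nbtw (y b) (x a) (x b) ybB xaA xbA; lia.
case=> ncr1 ncr2; rewrite /weakly_separated -/A -/B.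
have bndA z : z \in A :\: B -> x a <= z <= x b.
  by rewrite memA => /andP[/orP[]/eqP-> _]; lia.
have bndB z : z \in B :\: A -> y a <= z <= y b.
  by rewrite memB => /andP[/orP[]/eqP-> _]; lia.
case: (splits_aroundP disAB) => //= nAB; apply/splits_aroundP => // q s t.
move=> qB sA tA; apply/negP=> lt_q; apply: nAB => p u v pA uB vB.
apply/negP=> lt_p.
have {u v uB vB lt_p} lt_p : y a < p < y b by have := bndB u uB; have := bndB v vB; lia.
have {s t sA tA lt_q} lt_q : x a < q < x b by have := bndA s sA; have := bndA t tA; lia.
move: pA qB; rewrite memA memB => /andP[+ _] /andP[+ _].
by case/orP=> /eqP ep /orP[]/eqP eq; subst p q; lia.
Qed.

(** Distinct inner segments exclude both crossings, which accounts for the second alternative in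
    [noncrossing]; otherwise the two crossings express the failure of weak separation. *)
Lemma noncrossing_columnsP (x y : 'I_k -> 'I_n) : increasing x -> increasing y ->
  noncrossing_columns (column x) (column y) <->
  (forall a b, a < b < k -> ~ crossing (entry (column x)) (entry (column y)) a b /\
                            ~ crossing (entry (column y)) (entry (column x)) a b).
Proof.
move=> incx incy.
have innerP (a b : 'I_k) u v :
    (forall l, a < l < b -> entry (column u) l = entry (column v) l) <->
    (forall l : 'I_k, a < l < b -> u l = v l).
  split=> eq_uv l lt_l; first by have := eq_uv l lt_l; rewrite !entry_column => -[/val_inj].
  have lt_lk : l < k by have := ltn_ord b; lia.
  by rewrite -[l]/(val (Ordinal lt_lk)) !entry_column eq_uv.
split=> [nc a b /andP[lt_ab lt_bk] | nc].
  have lt_ak := ltn_trans lt_ab lt_bk.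
  pose a' := Ordinal lt_ak; pose b' := Ordinal lt_bk.
  have := forallP (forallP nc a') b'.
  rewrite lt_ab /=; set ws := weakly_separated _ _ => nc_ab.
  have sep : (forall l, a < l < b -> entry (column x) l = entry (column y) l) ->
      ~ [&& x a' < y a', y a' < x b' & x b' < y b'] /\
      ~ [&& y a' < x a', x a' < y b' & y b' < x b'].
    move/(innerP a' b') => eq_in.
    apply/(@weakly_separatedP x y a' b' incx incy lt_ab eq_in).
    have eqI := (inner_segment_eq a b incx incy).2 eq_in.
    by move: nc_ab; rewrite eqI eqxx orbF.
  rewrite -[a]/(val a') -[b]/(val b').
  split=> -[eq_in]; rewrite !entry_column !ltnS => lt1 lt2 lt3.
    by case: (sep eq_in); rewrite lt1 lt2 lt3.
  by case: sep => [l /eq_in-> // | _]; rewrite lt1 lt2 lt3.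
apply/forallP=> a; apply/forallP=> b; apply/implyP=> lt_ab.
apply/orP; case: eqP => [eqI | _]; [left | by right].
have eq_in := (inner_segment_eq a b incx incy).1 eqI.
apply/(weakly_separatedP incx incy lt_ab eq_in).
have [|nc1 nc2] := nc a b; first by rewrite lt_ab /=.
have eq_in' := (innerP a b x y).2 eq_in.
split=> /and3P[lt1 lt2 lt3]; [apply: nc1 | apply: nc2].
  by split; rewrite ?entry_column.
by split=> [l /eq_in' | | |]; rewrite ?entry_column.
Qed.

End Columns.

(** * Decompositions as families of words *)

Lemma words_of_size R m r Q : words_of R m r Q -> size Q = m.
Proof.
elim: r Q => [|r IHr] Q /=; first by move/perm_size->; rewrite size_nseq.
by case=> _ _ /IHr; rewrite size_map.
Qed.

(** Strictness at each row makes every word the code of an increasing column with entries in the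
    prescribed rows, hence decodable to a tableau. *)
Lemma words_of_code R m r Q q : words_of R m r Q -> q \in Q ->
  exists2 v, q = code v r &
    (forall i, i < r -> v i \in R i) /\ (forall i j, i < j < r -> v i < v j).
Proof.
elim: r Q q => [|r IHr] Q q /=.
  move=> eqQ; rewrite (perm_mem eqQ) mem_nseq => /andP[_ /eqP->].
  by exists id; split=> // i j; rewrite ltn0 andbF.
case=> -[/(_ q) + _] eqH wQ qQ => /(_ qQ)[q_n0 lt_q].
have [|v def_v [Rv mono_v]] := IHr _ (behead q : word) wQ.
  exact: (map_f (behead : word -> word)).
have Rq : head 0 q \in R r by rewrite -(perm_mem eqH); apply: map_f.
exists (fun i => if i == r then head 0 q else v i).
  rewrite eqxx (@eq_code _ v) => [|i lt_ir]; last by rewrite (ltn_eqF lt_ir).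
  by rewrite -def_v; case: (q) q_n0.
split=> [i | i j /andP[lt_ij]].
  by rewrite ltnS leq_eqVlt; case: eqP => [-> | _ /= /Rv].
rewrite ltnS leq_eqVlt => /predU1P[eq_jr | lt_jr]; last first.
  by rewrite (ltn_eqF lt_jr) (ltn_eqF (ltn_trans lt_ij lt_jr)) mono_v ?lt_ij.
rewrite eq_jr eqxx in lt_ij *; rewrite (ltn_eqF lt_ij).
apply: leq_ltn_trans lt_q; rewrite def_v.
case: r lt_ij {Rv def_v IHr wQ eqH eq_jr Rq} mono_v => //= r.
rewrite ltnS leq_eqVlt => /predU1P[-> // | lt_ir] mono_v.
by apply/ltnW/mono_v; rewrite lt_ir /=.
Qed.

Section Decomposition.

Variables k n : nat.

Implicit Types (C T : tableau k n) (s : seq (tableau k n)).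

(** The shift by one makes all entries positive, hence greater than the default 0 of the empty
    prefix. *)
Definition tableau_row (T : tableau k n) (r : nat) : seq nat :=
  oapp (fun i => [seq (x : 'I_n).+1 | x <- T i]) [::] (insub r).

Lemma tableau_row_ord T (i : 'I_k) : tableau_row T i = [seq x.+1 | x : 'I_n <- T i].
Proof. by rewrite /tableau_row valK. Qed.

Lemma perm_tableauU s i :
  perm_eq ((\big[@tableauU k n/tableau0 k n]_(C <- s) C) i) (flatten [seq C i | C <- s]).
Proof.
elim: s => [|C s IHs]; first by rewrite big_nil ffunE.
by rewrite big_cons ffunE perm_sort /= perm_cat2l.
Qed.

Lemma ord_le_total : total (@ord_le n).
Proof. by move=> x y; apply: leq_total. Qed.

Lemma ord_le_trans : transitive (@ord_le n).
Proof. by move=> y x z; apply: leq_trans. Qed.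

Lemma ord_le_anti : antisymmetric (@ord_le n).
Proof. by move=> x y /anti_leq/val_inj. Qed.

Lemma sorted_tableauU s i :
  sorted (@ord_le n) ((\big[@tableauU k n/tableau0 k n]_(C <- s) C) i).
Proof.
case: s => [|C s]; first by rewrite big_nil ffunE.
by rewrite big_cons ffunE; apply/sort_sorted/ord_le_total.
Qed.

(** The columns of the tableau already match each entry with a larger one below it. *)
Lemma hall_all2 (s t : seq 'I_n) : all2 (@ord_lt n) s t ->
  hall [seq x.+1 | x : 'I_n <- s] [seq x.+1 | x : 'I_n <- t].
Proof.
move=> + z; elim: s t => [|x s IHs] [|y t] //= /andP[lt_xy /IHs].
by apply: leq_add; move: lt_xy; rewrite /ord_lt /=; case: leqP => //; lia.
Qed.

Lemma perm_entries s (i : 'I_k) : {in s, forall C, is_SSYT 1 C} ->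
  [seq entry C i | C <- s] = [seq x.+1 | x : 'I_n <- flatten [seq C i | C <- s]].
Proof.
elim: s => //= C s IHs one; rewrite map_cat -IHs; last first.
  by move=> C1 C1s; apply: one; rewrite inE C1s orbT.
have /columnP[x -> _] := one C (mem_head _ _).
by rewrite entry_column ffunE.
Qed.

(** A sorted row is determined by its multiset of entries. *)
Lemma tableauU_rowP T s : {in s, forall C, is_SSYT 1 C} ->
  (forall i, sorted (@ord_le n) (T i)) ->
  T = \big[@tableauU k n/tableau0 k n]_(C <- s) C <->
  (forall r, r < k -> perm_eq [seq entry C r | C <- s] (tableau_row T r)).
Proof.
move=> one sortT; split=> [-> r lt_rk | eqT].
  rewrite -[r]/(val (Ordinal lt_rk)) tableau_row_ord perm_entries //.
  by rewrite perm_map // perm_sym perm_tableauU.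
apply/ffunP=> i; apply: (sorted_eq ord_le_trans ord_le_anti) => //.
  exact: sorted_tableauU.
rewrite (permPr (perm_tableauU _ _)) perm_sym.
have := eqT i (ltn_ord i); rewrite tableau_row_ord perm_entries //.
by apply: perm_map_inj => x y [/val_inj].
Qed.

(** The pairs of rows [a < b] are grouped by [b]: all crossings ending at [b] are excluded by the
    greedy condition there. *)
Lemma greedy_codes s : {in s, forall C, is_SSYT 1 C} ->
  {in s &, forall C C', noncrossing_columns C C'} <->
  (forall r, r < k -> greedy [seq (code (entry C) r.+1 : word) | C <- s]).
Proof.
move=> one.
have mono C r : C \in s -> r < k -> forall i j, i < j <= r -> entry C i < entry C j.
  move=> /one/columnP[x -> incx] lt_rk i j /andP[lt_ij le_jr].
  by apply: entry_increasing; rewrite // lt_ij (leq_ltn_trans le_jr).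
have ncP C C' : C \in s -> C' \in s -> noncrossing_columns C C' <->
    (forall a b, a < b < k -> ~ crossing (entry C) (entry C') a b /\
                              ~ crossing (entry C') (entry C) a b).
  by move=> /one/columnP[x -> incx] /one/columnP[y -> incy]; apply: noncrossing_columnsP.
split=> [nc r lt_rk | gs C C' Cs C's].
  split=> [_ /mapP[C Cs ->] | _ _ /mapP[C Cs ->] /mapP[C' C's ->] /=].
    split=> //=; case: r lt_rk => [|r] lt_rk /=; last by apply: (mono C r.+1); rewrite ?ltnSn.
    have /columnP[x -> _] := one C Cs.
    by rewrite -[0]/(val (Ordinal lt_rk)) entry_column.
  apply/(greedy_crossingP (mono C' r C's lt_rk) (mono C r Cs lt_rk)) => a lt_ar.
  have /ncP-/(_ C's Cs) nc' := nc C' C C's Cs.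
  by case: (nc' a r) => //; rewrite lt_ar.
apply/ncP=> // a b /andP[lt_ab lt_bk]; have [_ g2] := gs b lt_bk.
have ncr C1 C2 : C1 \in s -> C2 \in s -> ~ crossing (entry C1) (entry C2) a b.
  move=> C1s C2s.
  apply: (greedy_crossingP (mono _ b C1s lt_bk) (mono _ b C2s lt_bk)).1 lt_ab.
  by apply: (g2 (code _ b.+1) (code _ b.+1)); apply/mapP; [exists C2 | exists C1].
by split; apply: ncr.
Qed.

Lemma words_of_codesP T m s r : size s = m ->
  (forall i, i < r ->
     greedy [seq (code (entry C) i.+1 : word) | C <- s] /\
     perm_eq [seq entry C i | C <- s] (tableau_row T i)) <->
  words_of (tableau_row T) m r [seq (code (entry C) r : word) | C <- s].
Proof.
move=> <-; elim: r => [|r IHr].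
  split=> // _; suff -> : [seq (code (entry C) 0 : word) | C <- s] = nseq (size s) [::].
    exact: perm_refl.
  by elim: s => //= C s ->.
rewrite /= -!map_comp /=; split=> [wQ | [gQ eqH wQ] i].
  have [gQ eqH] := wQ r (leqnn _); split=> //.
  by apply/IHr=> i lt_ir; apply/wQ/ltnW.
rewrite ltnS leq_eqVlt => /predU1P[-> // | lt_ir].
by move/IHr: wQ; apply.
Qed.

(** Reduces the theorem to existence and uniqueness of families of words. *)
Lemma noncrossing_decompositionP m T (s : m.-tuple (tableau k n)) :
  (forall i, sorted (@ord_le n) (T i)) -> {in s, forall C, is_SSYT 1 C} ->
  noncrossing_decomposition T s <->
  words_of (tableau_row T) m k [seq (code (entry C) k : word) | C <- s].
Proof.
move=> sortT one; split=> [[_ nc defT] | /words_of_codesP-/(_ (size_tuple s)) wQ].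
  have nc' : {in s &, forall C C', noncrossing_columns C C'}.
    (* Decompositions compare distinct positions only; a column never crosses itself, as that would
       need [v a < v a]. *)
    move=> _ _ /tnthP[i ->] /tnthP[j ->]; case: (eqVneq i j) => [<- | ]; last exact: nc.
    have /columnP[x -> incx] := one _ (mem_tnth i s).
    by apply/(noncrossing_columnsP incx incx) => a b _; split=> -[_]; rewrite ltnn.
  apply/words_of_codesP=> [|r lt_rk]; first exact: size_tuple.
  by split; [apply: (greedy_codes one).1 | apply: (tableauU_rowP one sortT).1].
split=> // [i j _ |].
  by apply: (greedy_codes one).2 => [r /wQ[] // | |]; apply: mem_tnth.
by apply/(tableauU_rowP one sortT) => r /wQ[].
Qed.

(** Words list rows from last to first, whence the index [k.-1 - i]. Filtering [enum 'I_n] keeps the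
    map total: a letter outside 1, ..., n yields an empty row. *)
Definition decode (q : word) : tableau k n :=
  [ffun i : 'I_k => [seq x : 'I_n <- enum 'I_n | x.+1 == nth 0 q (k.-1 - i)]].

Lemma nth_code v r i : i < r -> nth 0 (code v r) (r.-1 - i) = v i.
Proof.
elim: r => // r IHr; rewrite ltnS leq_eqVlt => /predU1P[-> | lt_ir].
  by rewrite subnn.
by rewrite -IHr //; case: r lt_ir {IHr} => //= r lt_ir; rewrite subSn.
Qed.

Lemma decodeK C : is_SSYT 1 C -> decode (code (entry C) k) = C.
Proof.
case/columnP=> x -> _; apply/ffunP=> i; rewrite ffunE nth_code // entry_column [RHS]ffunE.
rewrite (@eq_filter _ _ (pred1 (x i))) ?filter_pred1_uniq ?enum_uniq ?mem_enum //.
Qed.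

Lemma code_column (v : nat -> nat) : (forall i : 'I_k, 0 < v i <= n) ->
  (forall i j, i < j < k -> v i < v j) ->
  exists2 C : tableau k n, is_SSYT 1 C & code (entry C) k = code v k.
Proof.
move=> bnd_v mono_v.
have lt_vn (i : 'I_k) : (v i).-1 < n by have := bnd_v i; lia.
exists (column (fun i => Ordinal (lt_vn i))).
  apply/columnP; eexists; first by [].
  move=> i j lt_ij /=; have := bnd_v i; have := mono_v i j; rewrite lt_ij ltn_ord; lia.
apply: eq_code => i lt_ik; rewrite -[i]/(val (Ordinal lt_ik)) entry_column /=.
by rewrite prednK //; case/andP: (bnd_v (Ordinal lt_ik)).
Qed.

Lemma words_of_tableau m T : is_SSYT m T ->
  exists Q, words_of (tableau_row T) m k Q.
Proof.
case/and3P=> /forallP szT _ /forallP ltT; apply: words_of_exists => [i lt_ik | lt0k | i lt_ik].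
- by rewrite -[i]/(val (Ordinal lt_ik)) tableau_row_ord size_map; apply/eqP.
- by rewrite -[0]/(val (Ordinal lt0k)) tableau_row_ord; apply/allP=> _ /mapP[x _ ->].
have lt_ik' := ltnW lt_ik.
rewrite -[i]/(val (Ordinal lt_ik')) -[i.+1]/(val (Ordinal lt_ik)) !tableau_row_ord.
apply: hall_all2; have /forallP/(_ (Ordinal lt_ik))/implyP := ltT (Ordinal lt_ik').
by apply; rewrite /=.
Qed.

End Decomposition.

Theorem lemma3p3 (k n : nat) (hk : 1 <= k) (hn : 1 <= n) (m : nat)
    (T : tableau k n) (hT : is_SSYT m T) :
  exists s : m.-tuple (tableau k n),
    noncrossing_decomposition T s /\
    forall s' : m.-tuple (tableau k n),
      noncrossing_decomposition T s' -> perm_eq s s'.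
Proof.
have sortT i : sorted (@ord_le n) (T i) by case/and3P: hT => _ /forallP.
have [Q wQ] := words_of_tableau hT.
have decQ q : q \in Q -> is_SSYT 1 (decode k n q) /\ code (entry (decode k n q)) k = q.
  move=> qQ; have [v -> [Rv mono_v]] := words_of_code wQ qQ.
  have [|C oneS <-] := @code_column k n v _ mono_v; last by rewrite decodeK.
  by move=> i; have := Rv i (ltn_ord i); rewrite tableau_row_ord => /mapP[x _ ->]; rewrite /=.
have sz_s : size [seq decode k n q | q <- Q] == m by rewrite size_map (words_of_size wQ).
pose s := Tuple sz_s.
have one : {in s, forall C, is_SSYT 1 C} by move=> _ /mapP[q /decQ[] + _ ->].
have codes : [seq (code (entry C) k : word) | C <- s] = Q.
  by rewrite -map_comp -[RHS]map_id; apply/eq_in_map=> q /decQ[].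
exists s; split; first by apply/noncrossing_decompositionP; rewrite ?codes.
move=> s' dec'; have [one' _ _] := dec'.
have wQ' := (noncrossing_decompositionP sortT one').1 dec'.
(* Decoding inverts coding on one-column tableaux, so uniqueness passes from the words to the
   columns. *)
have -> : tval s' = [seq decode k n q | q <- [seq (code (entry C) k : word) | C <- s']].
  by rewrite -map_comp -[LHS]map_id; apply/eq_in_map=> C /one' /= /decodeK->.
by apply: perm_map; apply: words_of_unique wQ wQ'.
Qed.
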